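(* Consider the iteration $i$ of the inexact Uzawa algorithm described in the context, applied to the generalized saddle-point system, with $f_i\neq0$, $g_i\neq0$ and damping parameter $\theta_i>0$. Let $c_1$ be a constant satisfying $c_1\,R^tQ_i^{-1}R\ge\Sigma_0^tU^tQ_i^{-1}U\Sigma_0$, and for $\mu\in(\alpha,1)$ put $$\gamma(\mu,\alpha,c_1)=\frac{(\mu+1)(\mu-\alpha)}{\alpha c_1(\mu+1)+\mu-\alpha}.$$ For any $\mu\in(\alpha,1)$, if $\theta_i$ satisfies $$\theta_i\le\frac{1}{\delta_2(1+\beta)}\,\gamma(\mu,\alpha,c_1)$$ and $\tilde\mu\in[\beta,1)$ satisfies $$1-\tilde\mu\le\frac{\delta_1(1-\beta)}{1+c_1\frac{\alpha}{\alpha+\beta}\gamma(\mu,\alpha,c_1)}\,\theta_i,$$ then $$-\tilde\mu I\le F_i\le\mu I,\qquad F_i=\begin{pmatrix}\alpha\,(I+\Sigma_0^tU^tQ_i^{-1}U\Sigma_0) & \sqrt{\alpha}\,\Sigma_0^tU^tQ_i^{-1}R\\ \sqrt{\alpha}\,R^tQ_i^{-1}U\Sigma_0 & -(I-R^tQ_i^{-1}R)\end{pmatrix},$$ and the convergence rate is $\rho=\max\{\mu,\tilde\mu\}$, i.e. $$|E^{(1)}_{i+1}|^2+|E^{(2)}_{i+1}|^2\le\rho^2\Big(\frac{\alpha_i^2}{\alpha^2}|E^{(1)}_i|^2+|E^{(2)}_i|^2\Big).$$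
   Context: Problem. $A\in\mathbb{R}^{n\times n}$ is symmetric positive definite, $B\in\mathbb{R}^{n\times m}$ with $1\le m\le n$, $D\in\mathbb{R}^{m\times m}$ is symmetric positive semidefinite, and $S=B^tA^{-1}B+D$ is positive definite. Given $f\in\mathbb{R}^n,g\in\mathbb{R}^m$, $(x,y)$ is the unique solution of $Ax+By=f$, $B^tx-Dy=g$. $\hat A\in\mathbb{R}^{n\times n}$ and $\hat S\in\mathbb{R}^{m\times m}$ are symmetric positive definite (preconditioners), and $H=B^t\hat A^{-1}B+D$. For symmetric matrices, $C_1\le C_2$ means $\langle C_1\phi,\phi\rangle\le\langle C_2\phi,\phi\rangle$ for all $\phi$. $|\cdot|$ is the Euclidean norm. Algorithm. From $(x_i,y_i)$: $f_i=f-(Ax_i+By_i)$, $r_i=\hat A^{-1}f_i$, $\omega_i=\langle f_i,r_i\rangle/\langle Ar_i,r_i\rangle$, $x_{i+1}=x_i+\omega_ir_i$; $g_i=B^tx_{i+1}-Dy_i-g$, $s_i=\hat S^{-1}g_i$, $\hat\tau_i=\langle g_i,s_i\rangle/\langle Hs_i,s_i\rangle$, $\tau_i=\theta_i\hat\tau_i$, $y_{i+1}=y_i+\tau_is_i$, where $\theta_i>0$ is a damping parameter. Constants. For $M$ with positive real eigenvalues, $\mathrm{cond}(M)$ is the ratio of its largest to its smallest eigenvalue. $\kappa_1=\mathrm{cond}(\hat A^{-1}A)$, $\kappa_2=\mathrm{cond}(\hat S^{-1}H)$, $\alpha=\frac{\kappa_1-1}{\kappa_1+1}$, $\beta=\frac{\kappa_2-1}{\kappa_2+1}$.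 $0<\lambda\le1\le\lambda_0$ are constants with $\lambda\hat A\le A\le\lambda_0\hat A$. $c_0$ is the largest eigenvalue of $D^{-1}B^t\hat A^{-1}B$ ($c_0=\infty$ if $D$ is singular). $\delta_1=\frac{\lambda_0+c_0}{\lambda_0(1+c_0)}$, $\delta_2=\frac{\lambda+c_0}{\lambda(1+c_0)}$ (so $\delta_1=1/\lambda_0$, $\delta_2=1/\lambda$ if $c_0=\infty$). Further $$\alpha_i=\frac{|(I-\omega_iA^{1/2}\hat A^{-1}A^{1/2})A^{-1/2}f_i|}{|A^{-1/2}f_i|},\qquad \beta_i=\frac{|(I-\hat\tau_iH^{1/2}\hat S^{-1}H^{1/2})H^{-1/2}g_i|}{|H^{-1/2}g_i|};$$ one has $0\le\alpha_i\le\alpha$ and $0\le\beta_i\le\beta$. Matrices. $G_i$ is a symmetric positive definite $m\times m$ matrix such that $G_i^{-1}g_i=\hat\tau_i\hat S^{-1}g_i$ and all eigenvalues of $S^{1/2}G_i^{-1}S^{1/2}$ lie in $[(1-\beta_i)\delta_1,(1+\beta_i)\delta_2]$ (such a matrix exists). $Q_i$ is defined by $Q_i^{-1}=\theta_iG_i^{-1}$. $B^tA^{-1/2}=U\Sigma V^t$ is a singular value decomposition with $U\in\mathbb{R}^{m\times m}$, $V\in\mathbb{R}^{n\times n}$ orthogonal, $\Sigma=[\Sigma_0,\,0]$, $\Sigma_0\in\mathbb{R}^{m\times m}$ diagonal. $R\in\mathbb{R}^{m\times m}$ is nonsingular with $S=RR^t$. Errors. $E^{(1)}_i=\sqrt{\alpha}\,V^tA^{-1/2}f_i$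 and $E^{(2)}_i=R^t(y-y_i)$ (and likewise with $i+1$, $f_{i+1}=f-Ax_{i+1}-By_{i+1}$). If $\alpha=0$, the terms $\frac{\alpha_i^2}{\alpha^2}|E_i^{(1)}|^2$ and $\frac{\alpha}{\alpha+\beta}$ are read as $0$. *)

(* Defs.v *)
From mathcomp Require Import all_boot all_order all_algebra.
From mathcomp Require Import constructive_ereal.

Set Implicit Arguments.
Unset Strict Implicit.
Unset Printing Implicit Defensive.

Import Order.TTheory GRing.Theory Num.Theory.

Local Open Scope ring_scope.

Definition dot (K : rcfType) (p : nat) (u v : 'cV[K]_p) : K := (u^T *m v) 0 0.

Definition enorm (K : rcfType) (p : nat) (u : 'cV[K]_p) : K :=
  Num.sqrt (dot u u).

Definition symmx (K : rcfType) (p : nat) (C : 'M[K]_p) : Prop := C^T = C.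

Definition sympsd (K : rcfType) (p : nat) (C : 'M[K]_p) : Prop :=
  symmx C /\ forall phi : 'cV[K]_p, 0 <= dot (C *m phi) phi.

Definition sympd (K : rcfType) (p : nat) (C : 'M[K]_p) : Prop :=
  symmx C /\ forall phi : 'cV[K]_p, phi != 0 -> 0 < dot (C *m phi) phi.

(* The Loewner order; MathComp's own <= on matrices (scope %MS) is inclusion
   of row spaces. *)
Definition loewner_le (K : rcfType) (p : nat) (C1 C2 : 'M[K]_p) : Prop :=
  forall phi : 'cV[K]_p, dot (C1 *m phi) phi <= dot (C2 *m phi) phi.

Definition orthogonalmx (K : rcfType) (p : nat) (U : 'M[K]_p) : Prop :=
  U^T *m U = 1%:M.

(* X = C^{1/2} for C symmetric positive definite; such an X exists and is
   unique, and C^{-1/2} is then invmx X. *)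
Definition is_sqrtmx (K : rcfType) (p : nat) (C X : 'M[K]_p) : Prop :=
  sympd X /\ X *m X = C.

Definition largest_eigenvalue (K : rcfType) (p : nat) (M : 'M[K]_p) (a : K)
  : Prop := eigenvalue M a /\ forall b, eigenvalue M b -> b <= a.

Definition smallest_eigenvalue (K : rcfType) (p : nat) (M : 'M[K]_p) (a : K)
  : Prop := eigenvalue M a /\ forall b, eigenvalue M b -> a <= b.

Definition is_cond (K : rcfType) (p : nat) (M : 'M[K]_p) (k : K) : Prop :=
  exists a b : K,
    [/\ largest_eigenvalue M a, smallest_eigenvalue M b & k = a / b].

(* c is the largest eigenvalue of D^{-1} N, or +oo if D is singular. *)
Definition is_c0 (K : rcfType) (p : nat) (D N : 'M[K]_p) (c : \bar K) : Prop :=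
  if D \in unitmx
  then exists2 a : K, largest_eigenvalue (invmx D *m N) a & c = EFin a
  else c = +oo%E.

(* (l + c) / (l (1 + c)), with its limit 1 / l at c = +oo; the value at -oo is
   irrelevant. *)
Definition delta (K : rcfType) (l : K) (c : \bar K) : K :=
  if c is EFin a then (l + a) / (l * (1 + a)) else l^-1.

Definition gamma (K : rcfType) (mu alpha c1 : K) : K :=
  (mu + 1) * (mu - alpha) / (alpha * c1 * (mu + 1) + mu - alpha).

(* [S0, 0] when m <= n: pid_mx m is then the m x n matrix [I, 0]. *)
Definition pad0 (K : rcfType) (m n : nat) (S0 : 'M[K]_m) : 'M[K]_(m, n) :=
  S0 *m pid_mx m.

(* M = U [S0, 0] V^T *)
Definition is_svd (K : rcfType) (m n : nat) (M : 'M[K]_(m, n))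
    (U S0 : 'M[K]_m) (V : 'M[K]_n) : Prop :=
  [/\ orthogonalmx U, orthogonalmx V,
      is_diag_mx S0 /\ (forall i, 0 <= S0 i i) &
      M = U *m pad0 n S0 *m V^T].

(* Main.v *)
(* Put T = Q_i^{-1}, X = U Sigma_0 and w = (I - omega_i W) A^{-1/2} f_i with
   W = A^{1/2} hatA^{-1} A^{1/2}, so that |w| = alpha_i |A^{-1/2} f_i|.  In the
   unknowns p = (V^t w)_{1..m} / sqrt alpha and e = E2_i, the new errors
   (E1_{i+1})_{1..m} and E2_{i+1} are the two blocks of F_i (p, -e), while the
   last n - m components of V^t w / sqrt alpha are only multiplied by
   alpha < mu.  The quadratic form of F_i is
     alpha |p|^2 - |q|^2 + |sqrt alpha X p + R q|_T^2,
   and Young's inequality for the last square, weighted by means of gamma, gives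
   -mutilde <= F_i <= mu; as F_i is symmetric it then contracts by
   max (mu, mutilde).  The bounds alpha_i <= alpha and beta_i <= beta are
   Kantorovich's inequality. *)
Require Import Defs.
From mathcomp Require Import all_boot all_order all_algebra.
From mathcomp Require Import constructive_ereal.
From mathcomp Require Import complex ring lra.
Import Order.TTheory GRing.Theory Num.Theory.
Local Open Scope ring_scope.

Set Implicit Arguments.
Unset Strict Implicit.

(** * Inner products, definite matrices and Young's inequality *)

Section Dot.
Context {K : rcfType}.
Implicit Types p q : nat.

Lemma dotC p (u v : 'cV[K]_p) : dot u v = dot v u.
Proof. by rewrite /dot -[u^T *m v]trmxK mxE trmx_mul trmxK. Qed.

Lemma dotDl p (u v w : 'cV[K]_p) : dot (u + v) w = dot u w + dot v w.
Proof. by rewrite /dot linearD mulmxDl mxE. Qed.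

Lemma dotDr p (u v w : 'cV[K]_p) : dot u (v + w) = dot u v + dot u w.
Proof. by rewrite /dot mulmxDr mxE. Qed.

Lemma dotZl p a (u v : 'cV[K]_p) : dot (a *: u) v = a * dot u v.
Proof. by rewrite /dot linearZ -scalemxAl mxE. Qed.

Lemma dotZr p a (u v : 'cV[K]_p) : dot u (a *: v) = a * dot u v.
Proof. by rewrite dotC dotZl dotC. Qed.

Lemma dotNl p (u v : 'cV[K]_p) : dot (- u) v = - dot u v.
Proof. by rewrite -scaleN1r dotZl mulN1r. Qed.

Lemma dotNr p (u v : 'cV[K]_p) : dot u (- v) = - dot u v.
Proof. by rewrite dotC dotNl dotC. Qed.

Lemma dot0l p (u : 'cV[K]_p) : dot 0 u = 0.
Proof. by rewrite -(scale0r 0) dotZl mul0r. Qed.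

Definition dotE := (dotDl, dotDr, dotNl, dotNr, dotZl, dotZr).

Lemma dot_mull p q (M : 'M[K]_(p, q)) u v : dot (M *m u) v = dot u (M^T *m v).
Proof. by rewrite /dot trmx_mul mulmxA. Qed.

Lemma dotvv_sum p (u : 'cV[K]_p) : dot u u = \sum_i u i 0 ^+ 2.
Proof. by rewrite /dot mxE; apply: eq_bigr => i _; rewrite mxE expr2. Qed.

Lemma dotvv_ge0 p (u : 'cV[K]_p) : 0 <= dot u u.
Proof. by rewrite dotvv_sum sumr_ge0 // => i _; rewrite sqr_ge0. Qed.

Lemma dotvv_eq0 p (u : 'cV[K]_p) : (dot u u == 0) = (u == 0).
Proof.
apply/eqP/eqP => [|->]; last by rewrite dot0l.
rewrite dotvv_sum => /psumr_eq0P u0; apply/colP => i; rewrite mxE.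
by apply/eqP; rewrite -(sqrf_eq0 (u i 0)) u0 // => j _; rewrite sqr_ge0.
Qed.

Lemma dotvv_gt0 p (u : 'cV[K]_p) : (0 < dot u u) = (u != 0).
Proof. by rewrite lt0r dotvv_eq0 dotvv_ge0 andbT. Qed.

Lemma enorm_sqr p (u : 'cV[K]_p) : enorm u ^+ 2 = dot u u.
Proof. by rewrite sqr_sqrtr ?dotvv_ge0. Qed.

Lemma dot_isometry p q (M : 'M[K]_(p, q)) u v :
  M^T *m M = 1%:M -> dot (M *m u) (M *m v) = dot u v.
Proof. by move=> MM; rewrite dot_mull mulmxA MM mul1mx. Qed.

Lemma dot_col_mx p q (u u' : 'cV[K]_p) (v v' : 'cV[K]_q) :
  dot (col_mx u v) (col_mx u' v') = dot u u' + dot v v'.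
Proof. by rewrite /dot tr_col_mx mul_row_col mxE. Qed.

Lemma dot_symm p (C : 'M[K]_p) u v : symmx C -> dot (C *m u) v = dot u (C *m v).
Proof. by move=> CT; rewrite dot_mull CT. Qed.

Lemma sympd_ge0 p (C : 'M[K]_p) u : sympd C -> 0 <= dot (C *m u) u.
Proof.
case=> _ Cpd; have [->|/Cpd/ltW//] := eqVneq u 0.
by rewrite dotC dot0l.
Qed.

Lemma sympd_unitmx p (C : 'M[K]_p) : sympd C -> C \in unitmx.
Proof.
case=> CT Cpd; rewrite -row_free_unit -kermx_eq0; apply/eqP/row_matrixP => i.
set v := row i _; have vC : v *m C = 0 by rewrite -row_mul mulmx_ker row0.
rewrite row0; apply: contraTeq isT => v0; have /Cpd : v^T != 0 by rewrite trmx_eq0.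
by rewrite -{1}CT -trmx_mul vC trmx0 dot0l ltxx.
Qed.

Lemma symmx_inv p (C : 'M[K]_p) : symmx C -> symmx (invmx C).
Proof. by move=> CT; rewrite /symmx trmx_inv CT. Qed.

Lemma sympd_inv p (C : 'M[K]_p) : sympd C -> sympd (invmx C).
Proof.
move=> Cpd; have Cu := sympd_unitmx Cpd; case: Cpd => CT Cpd.
split=> [|u u0]; first exact: symmx_inv.
rewrite dotC -{1}[u](mulKVmx Cu) Cpd //.
by apply: contraNneq u0 => iu0; rewrite -[u](mulKVmx Cu) iu0 mulmx0.
Qed.

(** Expanding [<T (e x - z), e x - z> >= 0] bounds the cross term, and dividing by [e] gives the two
    weights. *)
Lemma young p (T : 'M[K]_p) (x z : 'cV[K]_p) (e : K) : sympd T -> 0 < e ->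
  dot (T *m (x + z)) (x + z) <=
  (1 + e) * dot (T *m x) x + (1 + e^-1) * dot (T *m z) z.
Proof.
move=> Tpd e0.
have := sympd_ge0 (e *: x - z) Tpd; case: Tpd => TT _.
rewrite !mulmxDr mulmxN -scalemxAr !dotE.
rewrite (dot_symm z x) // (dotC _ z).
set a := dot (T *m x) x; set b := dot (T *m x) z; set c := dot _ z => h.
rewrite -(ler_pM2l e0).
have -> : e * ((1 + e) * a + (1 + e^-1) * c) = e * (1 + e) * a + (e + 1) * c.
  by field; lra.
nra.
Qed.

End Dot.

(** * From eigenvalues to bounds on the quadratic form *)

Section Spectral.
Local Open Scope sesquilinear_scope.
Local Open Scope complex_scope.
Context {K : rcfType}.

(* Diagonalises [T] over [K[i]], where the spectral theorem is available; the
   eigenvalues found there are real, hence eigenvalues of [T] over [K]. *)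
Lemma rayleigh_bounds p (T : 'M[K]_p) (lo hi : K) (u : 'cV[K]_p) : symmx T ->
  (forall a, eigenvalue T a -> lo <= a <= hi) ->
  lo * dot u u <= dot (T *m u) u <= hi * dot u u.
Proof.
move=> TT ev.
pose rc := real_complex K : {rmorphism K -> K[i]}.
have conjrc q r (M : 'M[K]_(q, r)) : (map_mx rc M)^t* = map_mx rc M^T.
  by apply/matrixP => i j; rewrite !mxE /=; exact: conjc_real.
pose TC := map_mx rc T.
have herm : TC \is hermsymmx.
  by apply/is_hermitianmxP; rewrite expr0 scale1r conjrc TT.
have /orthomx_spectralP := hermitian_normalmx herm.
have /mxOverP dreal := hermitian_spectral_diag_real herm.
set P := spectralmx TC; set d := spectral_diag TC => ET.
have Pu : P \is unitarymx by apply: spectral_unitarymx.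
have Pinv := unitarymx_unit Pu.
pose e i := complex.Re (d 0 i).
have dE i : d 0 i = rc (e i) by rewrite /= RRe_real // dreal.
(* Row [i] of the unitary [P] is a nonzero left eigenvector of [TC] for [d 0 i]; this value comes
   from [K], so it is an eigenvalue of [T] itself. *)
have eev i : lo <= e i <= hi.
  apply: ev; rewrite -(eigenvalue_map rc) -dE.
  apply/eigenvalueP; exists (row i P); last first.
    apply: contraTneq Pinv => ri0; rewrite -row_free_unit -kermx_eq0.
    apply/negP => /eqP k0.
    have : delta_mx 0 i *m P = 0 :> 'rV_p by rewrite -rowE.
    move/eqP; rewrite mulmx_free_eq0; last by rewrite -kermx_eq0 k0.
    by move/eqP/matrixP/(_ 0 i); rewrite !mxE !eqxx /= => /eqP; rewrite oner_eq0.
  rewrite -/TC -row_mul ET !mulmxA mulmxV // mul1mx.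
  by apply/rowP => j; rewrite mxE mul_diag_mx !mxE.
pose w := P *m map_mx rc u.
pose c i := complex.Re (`|w i 0| ^+ 2).
have cE i : rc (c i) = `|w i 0| ^+ 2 by rewrite /= RRe_real // ger0_real // exprn_ge0.
have c0 i : 0 <= c i by rewrite -ler0c [_%:C]cE exprn_ge0.
(* Stated for any [M] diagonalised by [P], since it serves twice: for [T], and for the identity,
   where it gives [|u|^2]. *)
have quad (D : 'rV[K]_p) (M : 'M[K]_p) :
    map_mx rc M = invmx P *m diag_mx (map_mx rc D) *m P ->
    dot (M *m u) u = \sum_i D 0 i * c i.
  move=> EM; apply: (@complexI K).
  rewrite -[LHS]/(rc _) -[RHS]/(rc _) dotC rmorph_sum /=.
  transitivity ((w^t* *m (diag_mx (map_mx rc D) *m w)) 0 0).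
    rewrite /w trmx_mul map_mxM -invmx_unitary // !mulmxA.
    rewrite conjrc -(mulmxA _ (invmx P)) -(mulmxA _ (_ *m _) P) -EM.
    by rewrite -!map_mxM mxE -mulmxA.
  rewrite mul_diag_mx mxE; apply: eq_bigr => i _; rewrite rmorphM -[RHS]/(rc _ * rc _) cE.
  by rewrite !mxE /= normCK mulrCA [X in _ * X]mulrC.
have := quad (\row_i e i) T; rewrite [LHS]ET.
have -> : map_mx rc (\row_i e i) = d by apply/rowP => i; rewrite !mxE dE.
move=> /(_ erefl) ->.
have := quad (const_mx 1) 1%:M.
rewrite map_mx1 map_const_mx rmorph1 diag_const_mx mulmx1 mulVmx // mul1mx.
move=> /(_ erefl) ->; rewrite !mulr_sumr.
apply/andP; split; apply: ler_sum => i _; rewrite !mxE mul1r ler_wpM2r //;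
  by case/andP: (eev i).
Qed.
End Spectral.

(** * Contraction from form bounds, and the exact line search *)

Section Descent.
Context {K : rcfType}.

(** This is [(W - lo) (hi - W) >= 0] tested at [u]. With [v = (W - lo) u] it reads
    [|v|^2 <= (hi - lo) <v, u>]. *)
Lemma dot_interval p (W : 'M[K]_p) (lo hi : K) u : symmx W -> lo <= hi ->
  (forall v, lo * dot v v <= dot (W *m v) v <= hi * dot v v) ->
  dot (W *m u) (W *m u) <= (lo + hi) * dot (W *m u) u - lo * hi * dot u u.
Proof.
move=> WT lohi bnd; have [v vdef] : exists v, v = W *m u - lo *: u by eexists.
have vE : dot v v = dot (W *m u) (W *m u) - 2 * lo * dot (W *m u) u
    + lo ^+ 2 * dot u u by rewrite vdef !dotE (dotC u); ring.
have vuE : dot v u = dot (W *m u) u - lo * dot u u by rewrite vdef !dotE.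
(* Positivity of [W - lo] at [u - s v], together with [W - lo <= hi - lo] at
   [v], gives [<v, u> - 2 s |v|^2 + s^2 (hi - lo) |v|^2 >= 0] for every s. *)
have key (s : K) : 0 <= dot v u - 2 * s * dot v v + s ^+ 2 * ((hi - lo) * dot v v).
  have /andP[+ _] := bnd (u - s *: v); have /andP[_] := bnd v.
  rewrite mulmxBr -scalemxAr !dotE (dot_symm v u) //.
  have -> : W *m u = v + lo *: u by rewrite vdef subrK.
  rewrite !dotE (dotC u v) => h1 h2.
  by have := ler_wpM2l (sqr_ge0 s) h1 => h3; lra.
suff : dot v v <= (hi - lo) * dot v u by rewrite vE vuE => h; lra.
(* If [lo = hi], then [<v, u> = 0] and [s = 1] forces [v = 0]; otherwise [s = 1 / (hi - lo)]
   minimises the quadratic in [key]. *)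
have := dotvv_ge0 v; move: lohi; rewrite le_eqVlt => /predU1P[E|lohi] v0.
  have := key 1; have := bnd u; rewrite vuE => /andP[h1 h2] h3; subst hi; lra.
have := key (hi - lo)^-1; set c := hi - lo in key *; have c0 : 0 < c by rewrite subr_gt0.
have -> : dot v u - 2 * c^-1 * dot v v + c^-1 ^+ 2 * (c * dot v v)
   = dot v u - dot v v / c by field; rewrite gt_eqF.
by rewrite subr_ge0 ler_pdivrMr // mulrC.
Qed.

(** On the interval [[-r, r]] the linear term of [dot_interval] vanishes. *)
Lemma dot_contract p (F : 'M[K]_p) (r : K) u : symmx F -> 0 <= r ->
  loewner_le (- r *: 1%:M) F -> loewner_le F (r *: 1%:M) ->
  dot (F *m u) (F *m u) <= r ^+ 2 * dot u u.
Proof.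
move=> FT r0 loF hiF.
have := @dot_interval p F (- r) r u FT; have -> : - r + r = 0 by ring.
have -> : 0 * dot (F *m u) u - - r * r * dot u u = r ^+ 2 * dot u u by ring.
apply=> [|v]; first lra.
by have := loF v; have := hiF v; rewrite -!scalemxAl !mul1mx !dotZl => -> ->.
Qed.

(** The products are similar, as [Q M = Q (M Q) Q^{-1}]. *)
Lemma eigenvalue_mulC p (M Q : 'M[K]_p) a : Q \in unitmx ->
  eigenvalue (M *m Q) a = eigenvalue (Q *m M) a.
Proof.
move=> Qu; apply/eigenvalueP/eigenvalueP => -[v vE v0].
  exists (v *m invmx Q); first by rewrite mulmxA mulmxKV // -(mulmxK Qu (v *m M))
    -(mulmxA v) vE scalemxAl.
  by apply: contraNneq v0 => vQ0; rewrite -[v](mulmxKV Qu) vQ0 mul0mx.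
exists (v *m Q); first by rewrite -mulmxA [Q *m _]mulmxA mulmxA vE scalemxAl.
by apply: contraNneq v0 => vQ0; rewrite -[v](mulmxK Qu) vQ0 mul0mx.
Qed.

Lemma symm_eigenvector p (M : 'M[K]_p) a : symmx M -> eigenvalue M a ->
  exists2 z : 'cV[K]_p, M *m z = a *: z & z != 0.
Proof.
move=> MT /eigenvalueP[v vE v0]; exists v^T; last by rewrite trmx_eq0.
by rewrite -{1}MT -trmx_mul vE linearZ.
Qed.

Lemma sympd_eigenvalue_gt0 p (M : 'M[K]_p) a : sympd M -> eigenvalue M a -> 0 < a.
Proof.
move=> [MT Mpd] /(symm_eigenvector MT)[z zE z0].
by have := Mpd z z0; rewrite zE dotZl pmulr_lgt0 // dotvv_gt0.
Qed.

Lemma sympd_congr p (M Q : 'M[K]_p) : sympd M -> Q \in unitmx -> sympd (Q^T *m M *m Q).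
Proof.
move=> [MT Mpd] Qu; split=> [|u u0].
  by rewrite /symmx !trmx_mul trmxK MT mulmxA.
rewrite -!mulmxA dot_mull trmxK Mpd //.
by apply: contraNneq u0 => Qu0; rewrite -[u](mulKmx Qu) Qu0 mulmx0.
Qed.

(* The step length minimises [|u - w W u|] along the search direction, where
   [W = C^{1/2} hatC^{-1} C^{1/2}]; the bound is then Kantorovich's inequality. *)
Lemma descent_ratio p (C X hatC : 'M[K]_p) (f : 'cV[K]_p) (k w : K) : is_sqrtmx C X ->
    sympd hatC -> is_cond (invmx hatC *m C) k ->
    w = dot f (invmx hatC *m f)
        / dot (C *m (invmx hatC *m f)) (invmx hatC *m f) ->
  1 <= k /\
  0 <= enorm ((1%:M - w *: (X *m invmx hatC *m X)) *m (invmx X *m f))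
       / enorm (invmx X *m f) <= (k - 1) / (k + 1).
Proof.
move=> [Xpd XX] hatCpd [hi [lo [[evhi lehi] [evlo lelo] kE]]].
have Xu := sympd_unitmx Xpd; have [XT _] := Xpd.
pose W := X *m invmx hatC *m X.
(* This passes from the preconditioned matrix to a similar symmetric one, to which Rayleigh bounds
   apply. *)
have evW a : eigenvalue (invmx hatC *m C) a = eigenvalue W a.
  by rewrite -XX mulmxA eigenvalue_mulC // mulmxA.
have Wpd : sympd W.
  by rewrite /W -{1}XT; apply: sympd_congr => //; apply: sympd_inv.
have lo0 : 0 < lo by apply: (sympd_eigenvalue_gt0 Wpd); rewrite -evW.
have lohi : lo <= hi by apply: lehi.
have k1 : 1 <= k by rewrite kE ler_pdivlMr // mul1r.
have [WT _] := Wpd.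
have bnd v : lo * dot v v <= dot (W *m v) v <= hi * dot v v.
  by apply: rayleigh_bounds => // a; rewrite -evW => ev; rewrite lelo // lehi.
rewrite -/W; set u := invmx X *m f.
have fE : f = X *m u by rewrite mulKVmx.
rewrite -XX fE -!mulmxA => wE.
have {}wE : w = dot (W *m u) u / dot (W *m u) (W *m u).
  by rewrite wE /W -!mulmxA !(dot_symm (X *m _) _ XT) !(dot_symm u _ XT) dotC.
split=> //; rewrite divr_ge0 ?sqrtr_ge0 //=.
have al0 : 0 <= (k - 1) / (k + 1) by rewrite divr_ge0 ?subr_ge0 ?addr_ge0 // (le_trans _ k1).
have [u0|u0] := eqVneq u 0; first by rewrite u0 mulmx0 /enorm dot0l sqrtr0 mul0r.
have uu0 : 0 < dot u u by rewrite dotvv_gt0.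
rewrite ler_pdivrMr ?sqrtr_gt0 // -ler_sqr ?nnegrE ?(mulr_ge0 al0) ?sqrtr_ge0 //.
rewrite exprMn !enorm_sqr mulmxBl mul1mx -scalemxAl.
have := dot_interval u WT lohi bnd; have /andP[+ _] := bnd u.
have := dotvv_ge0 (W *m u).
rewrite !dotE (dotC u (W *m u)).
set N := dot (W *m u) (W *m u) in wE *; set q := dot (W *m u) u in wE *.
set s := dot u u in uu0 *.
move=> N0 qlo Nle.
have {}N0 : 0 < N.
  rewrite lt0r N0 andbT dotvv_eq0; apply: contraTneq qlo => Wu0.
  by rewrite /q Wu0 dot0l -ltNge mulr_gt0.
(* The step [w = q / N] minimises [s - 2 w q + w^2 N]. *)
rewrite [X in X <= _](_ : _ = s - q ^+ 2 / N); last by rewrite wE; field; rewrite gt_eqF.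
have hl0 : 0 < hi + lo by rewrite addr_gt0 // (lt_le_trans lo0).
have -> : (k - 1) / (k + 1) = (hi - lo) / (hi + lo).
  by rewrite kE; field; rewrite !gt_eqF //= divr_gt0.
have -> : ((hi - lo) / (hi + lo)) ^+ 2 * s
   = s - 4 * (hi * lo) * s / (hi + lo) ^+ 2 by field; rewrite gt_eqF.
rewrite lerD2l lerN2 ler_pdivrMr ?exprn_gt0 // [q ^+ 2 / N * _]mulrAC ler_pdivlMr //.
have hls : 0 <= lo * hi * s by rewrite !mulr_ge0 // ltW // (lt_le_trans lo0).
clear -N0 Nle hls hl0.
(* [dot_interval] gives [N + lo hi s <= (lo + hi) q]; after squaring,
   [4 N lo hi s <= (N + lo hi s)^2] finishes. *)
have : (N + lo * hi * s) ^+ 2 <= ((lo + hi) * q) ^+ 2.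
  by rewrite ler_sqr ?nnegrE; lra.
have := sqr_ge0 (N - lo * hi * s) => h1 h2.
lra.
Qed.
End Descent.

(** * Scalar form of the two block estimates *)

(** The weight [e = (mu - a) / (k (mu + 1))] balances the two blocks: bounding the [pp] part by
    [mu - a] and the [qq] part by [mu + 1] both reduce to the bound on [t]. For [k = 0] this weight
    is infinite, so that case is separate. *)
Lemma young_upper {K : rcfType} (a mu k t xy xx yy pp qq : K) :
  0 <= a -> a < mu -> 0 <= k ->
  t <= (mu + 1) * (mu - a) / (k * (mu + 1) + mu - a) ->
  (k = 0 -> xy = yy) -> xx <= k * t * pp -> yy <= t * qq -> 0 <= qq -> 0 <= pp ->
  (forall e, 0 < e -> xy <= (1 + e) * xx + (1 + e^-1) * yy) ->
  a * pp - qq + xy <= mu * (pp + qq).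
Proof.
move=> a0 amu k0 tle xE xle yle qq0 pp0 yg.
have mu1 : 0 < mu + 1 by lra.
have ma : 0 < mu - a by lra.
move: k0; rewrite le_eqVlt => /predU1P[k0|k0].
  have tmu : t <= mu + 1 by move: tle; rewrite -k0 mul0r add0r mulfK ?gt_eqF.
  have := ler_wpM2r qq0 tmu; rewrite xE // => h.
  have := ler_wpM2r pp0 (ltW ma) => h'; lra.
pose d := k * (mu + 1) + mu - a.
have d0 : 0 < d by rewrite /d -addrA addr_gt0 // mulr_gt0.
have td : t * d <= (mu + 1) * (mu - a) by rewrite -ler_pdivlMr.
have e0 : 0 < (mu - a) / (k * (mu + 1)) by rewrite divr_gt0 // mulr_gt0.
have := yg _ e0.
have -> : 1 + (mu - a) / (k * (mu + 1)) = d / (k * (mu + 1)).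
  by rewrite /d; field; rewrite !gt_eqF.
have -> : 1 + ((mu - a) / (k * (mu + 1)))^-1 = d / (mu - a).
  by rewrite /d; field; rewrite !gt_eqF.
have xb : d / (k * (mu + 1)) * xx <= (mu - a) * pp.
  rewrite mulrAC ler_pdivrMr ?mulr_gt0 //.
  have := ler_wpM2l (ltW d0) xle => h; apply: le_trans h _.
  have := ler_wpM2l (mulr_ge0 (ltW k0) pp0) td; lra.
have yb : d / (mu - a) * yy <= (mu + 1) * qq.
  rewrite mulrAC ler_pdivrMr //.
  have := ler_wpM2l (ltW d0) yle => h; apply: le_trans h _.
  have := ler_wpM2l qq0 td; lra.
by move=> h; lra.
Qed.

(** Young's inequality reversed, [xy >= yy / (1 + e) - xx / e]. With [e = k t / (a + b)] the loss
    [xx / e] is at most [(a + b) pp]; since [a pp] is available, only [-b pp] remains, and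
    [b <= mt]. *)
Lemma young_lower {K : rcfType} (a b k t l mt xy xx yy pp qq : K) :
  0 <= a -> 0 <= b <= mt -> 0 <= k * t -> (a = 0 -> k * t = 0) ->
  1 - mt <= l / (1 + k * t / (a + b)) ->
  (k * t = 0 -> xy = yy) -> xx <= k * t * pp -> l * qq <= yy -> 0 <= qq -> 0 <= pp ->
  (forall e, 0 < e -> yy <= (1 + e) * xy + (1 + e^-1) * xx) ->
  - mt * (pp + qq) <= a * pp - qq + xy.
Proof.
move=> a0 /andP[b0 bmt]; move: (k * t) => s s0 ka lle xE xle yle qq0 pp0 yg.
have app : 0 <= a * pp by rewrite mulr_ge0.
have bpp : b * pp <= mt * pp by rewrite ler_wpM2r.
have := ler_wpM2r qq0 lle.
move: s0; rewrite le_eqVlt => /predU1P[s0|s0].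
  rewrite -s0 mul0r addr0 divr1 xE // => h.
  have := mulr_ge0 b0 pp0 => h'; lra.
have c0 : 0 < a + b.
  rewrite lt0r addr_ge0 // andbT paddr_eq0 //; apply: contraTN s0.
  by case/andP=> /eqP/ka-> _; rewrite ltxx.
set e := s / (a + b) => h; have e0 : 0 < e by rewrite divr_gt0.
have e1 : 0 < 1 + e by rewrite addr_gt0.
have := yg _ e0; have -> : 1 + e^-1 = (1 + e) * e^-1 by field; rewrite gt_eqF.
rewrite -mulrA -mulrDr -ler_pdivrMl // mulrC => h1.
have h2 : e^-1 * xx <= (a + b) * pp.
  rewrite mulrC ler_pdivrMr //; apply: (le_trans xle).
  by rewrite /e le_eqVlt; apply/orP; left; apply/eqP; field; rewrite gt_eqF.
have : l / (1 + e) * qq <= yy / (1 + e) by rewrite mulrAC ler_wpM2r // invr_ge0 ltW.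
by move=> h3; lra.
Qed.


(** * Spectral bounds for the block matrix and the error step *)

Section UzawaBlock.
Context {K : rcfType} {m : nat}.
Context (a : K) (T X R : 'M[K]_m) (a0 : 0 <= a) (Tpd : sympd T).

(** The matrix [F_i], with [T] for [Q_i^{-1}] and [X] for [U Sigma_0]. *)
Definition uzawa_block : 'M[K]_(m + m) := block_mx
  (a *: (1%:M + X^T *m T *m X)) (Num.sqrt a *: (X^T *m T *m R))
  (Num.sqrt a *: (R^T *m T *m X)) (- (1%:M - R^T *m T *m R)).

Lemma symmx_uzawa_block : symmx uzawa_block.
Proof.
have [TT _] := Tpd.
have sandwich (P Q : 'M[K]_m) : (P^T *m T *m Q)^T = Q^T *m T *m P.
  by rewrite !trmx_mul trmxK TT mulmxA.
rewrite /symmx /uzawa_block tr_block_mx [(- _)^T]linearN /= [(1%:M - _)^T]linearB /=.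
by rewrite ![(_ *: _)^T]linearZ /= [(1%:M + _)^T]linearD /= trmx1 !sandwich.
Qed.

Lemma uzawa_block_quad p q :
  dot (uzawa_block *m col_mx p q) (col_mx p q) =
  a * dot p p - dot q q
  + dot (T *m (Num.sqrt a *: (X *m p) + R *m q)) (Num.sqrt a *: (X *m p) + R *m q).
Proof.
have [TT _] := Tpd; rewrite /uzawa_block.
have [s -> ->] : exists2 s, Num.sqrt a = s & a = s ^+ 2.
  by exists (Num.sqrt a); rewrite ?sqr_sqrtr.
rewrite mul_block_col dot_col_mx -!scalemxAl mulNmx mulmxDl mulmxBl !mul1mx -!mulmxA.
rewrite mulmxDr -scalemxAr !dotE ![dot (_^T *m _) _]dot_mull !trmxK.
rewrite (dot_symm (R *m q) (X *m p)) // (dotC (R *m q)).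
ring.
Qed.

Lemma sympd_le0 x : dot (T *m x) x <= 0 -> x = 0.
Proof.
have [_ Tpos] := Tpd; move=> xle; apply/eqP; apply: contraTT isT => x0.
by have := Tpos x x0; rewrite ltNge xle.
Qed.

Lemma sqrt_scaled_le (c : K) p : (forall z, dot (T *m (X *m z)) (X *m z) <= c * dot z z) ->
  dot (T *m (Num.sqrt a *: (X *m p))) (Num.sqrt a *: (X *m p)) <= a * c * dot p p.
Proof.
move=> hX; rewrite -scalemxAr dotZl dotZr mulrA -expr2 sqr_sqrtr // -mulrA.
by rewrite ler_wpM2l.
Qed.

Lemma uzawa_block_le (c1 t mu : K) : a < mu -> 0 <= c1 -> 0 <= t -> t <= gamma mu a c1 ->
    (forall p, dot (T *m (X *m p)) (X *m p) <= c1 * t * dot p p) ->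
    (forall q, dot (T *m (R *m q)) (R *m q) <= t * dot q q) ->
  loewner_le uzawa_block (mu *: 1%:M).
Proof.
move=> amu c10 t0 tle hX hR u; rewrite -[u]vsubmxK.
move: (usubmx u) (dsubmx u) => p q {u}.
rewrite uzawa_block_quad -scalemxAl mul1mx dotZl dot_col_mx.
have := sqrt_scaled_le p hX; set x := Num.sqrt a *: (X *m p) => xle.
have := hR q; have yg e := @young _ _ _ x (R *m q) e Tpd.
have := dotvv_ge0 p; have := dotvv_ge0 q; have := sympd_ge0 x Tpd.
(* In the degenerate case definiteness of [T] forces [x = 0]. *)
have xE : a * c1 = 0 -> dot (T *m (x + R *m q)) (x + R *m q) = dot (T *m (R *m q)) (R *m q).
  by move=> k0; rewrite (@sympd_le0 x) ?add0r // (le_trans xle) // mulrA k0 !mul0r.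
have : 0 <= a * c1 by rewrite mulr_ge0.
move: tle xE xle yg; rewrite /gamma mulrA; clear Tpd hX hR.
move: (dot _ (x + _)) (dot _ x) (dot _ (R *m q)) (dot p p) (dot q q) (a * c1).
move=> xy xx yy pp qq k tle xE xle yg k0 xx0 qq0 pp0 yle; clear X R T x p q.
by apply: (@young_upper _ a mu k t xy xx yy).
Qed.

Lemma uzawa_block_ge (c1 t l b mt : K) : 0 <= c1 -> 0 <= t -> 0 <= b <= mt ->
    1 - mt <= l / (1 + c1 * (a / (a + b)) * t) ->
    (forall p, dot (T *m (X *m p)) (X *m p) <= c1 * t * dot p p) ->
    (forall q, l * dot q q <= dot (T *m (R *m q)) (R *m q)) ->
  loewner_le (- mt *: 1%:M) uzawa_block.
Proof.
move=> c10 t0 /andP[b0 bmt] lle hX hR u; rewrite -[u]vsubmxK.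
move: (usubmx u) (dsubmx u) => p q {u}.
rewrite uzawa_block_quad -scalemxAl mul1mx dotZl dot_col_mx.
have := sqrt_scaled_le p hX; set x := Num.sqrt a *: (X *m p) => xle.
(* Splitting [R q] as [(x + R q) + (- x)] turns Young's inequality into a lower bound for the
   square. *)
have := hR q; have yg e := @young _ _ _ (x + R *m q) (- x) e Tpd.
have := dotvv_ge0 p; have := dotvv_ge0 q; have := sympd_ge0 x Tpd.
have xE : a * c1 * t = 0 -> dot (T *m (x + R *m q)) (x + R *m q) = dot (T *m (R *m q)) (R *m q).
  by move=> k0; rewrite (@sympd_le0 x) ?add0r // (le_trans xle) // mulrA k0 !mul0r.
have kab : c1 * (a / (a + b)) * t = a * c1 * t / (a + b) by ring.
move: lle xE xle yg; rewrite kab mulrA addrAC subrr add0r mulmxN dotNl dotNr opprK.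
move=> lle xE xle yg xx0 qq0 pp0 yle.
apply: (@young_lower _ a b (a * c1) t l mt) xE xle yle qq0 pp0 yg => //.
- by rewrite b0.
- by rewrite !mulr_ge0.
- by move->; rewrite !mul0r.
Qed.

(* In the scaled unknowns [p = w / sqrt a] the part of the first error lying in
   the row space of [J] and the second error are the two blocks of
   [uzawa_block (p, -e)]; the rest of the first error is damped by [a <= r]. *)
Lemma uzawa_error_le n (J : 'M[K]_(m, n)) (w E1 : 'cV[K]_n) (e g E2 : 'cV[K]_m) (r : K) :
    J *m J^T = 1%:M -> (a = 0 -> w = 0) -> a <= r ->
    loewner_le (- r *: 1%:M) uzawa_block -> loewner_le uzawa_block (r *: 1%:M) ->
    g = R *m e - X *m (J *m w) ->
    E1 = Num.sqrt a *: (w - J^T *m (X^T *m (T *m g))) ->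
    E2 = e - R^T *m (T *m g) ->
  dot E1 E1 + dot E2 E2 <= r ^+ 2 * (a^-1 * dot w w + dot e e).
Proof.
move=> JJ w0 ar leF Fle gE E1E E2E.
pose w1 := J *m w; have [w2 w2E] : exists w2, w2 = w - J^T *m w1 by eexists.
have Jw2 : J *m w2 = 0 by rewrite w2E mulmxBr mulmxA JJ mul1mx subrr.
have split_dot z c : dot (J^T *m z + c *: w2) (J^T *m z + c *: w2)
    = dot z z + c ^+ 2 * dot w2 w2.
  rewrite !dotE (dotC _ (J^T *m z)) ![dot (J^T *m z) _]dot_mull trmxK.
  by rewrite Jw2 mulmxA JJ mul1mx (dotC z) dot0l; ring.
have wE : w = J^T *m w1 + 1 *: w2 by rewrite w2E scale1r addrC subrK.
pose z1 := Num.sqrt a *: (w1 - X^T *m (T *m g)).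
have {}E1E : E1 = J^T *m z1 + Num.sqrt a *: w2.
  rewrite E1E /z1 -scalemxAr -scalerDr mulmxBr w2E; congr (_ *: _).
  by rewrite [RHS]addrC addrA subrK.
(* For [a = 0] the inverse is 0, so [p = 0], consistent with [w = 0]. *)
pose p := (Num.sqrt a)^-1 *: w1.
have pE : Num.sqrt a *: p = w1.
  rewrite scalerA; have [sa0|sa] := eqVneq (Num.sqrt a) 0; last by rewrite divff ?scale1r.
  rewrite sa0 mul0r scale0r /w1 w0 ?mulmx0 //.
  by apply/eqP; rewrite eq_le a0 -sqrtr_eq0 sa0 eqxx.
have ppE : dot p p = a^-1 * dot w1 w1.
  by rewrite /p !dotE mulrA -expr2 exprVn sqr_sqrtr.
have FE : uzawa_block *m col_mx p (- e) = col_mx z1 E2.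
  rewrite mul_block_col; congr col_mx.
    rewrite -!scalemxAl -{1}(sqr_sqrtr a0) expr2 -scalerA scalemxAr pE -scalerDr.
    rewrite /z1 gE mulmxDl mul1mx !mulmxN !mulmxBr -!mulmxA -/w1; congr (_ *: _).
    by rewrite opprB addrA.
  rewrite -scalemxAl scalemxAr pE E2E gE mulmxN mulNmx opprK mulmxBl mul1mx !mulmxBr.
  by rewrite -!mulmxA -/w1 opprB addrC -addrA [X in _ + X]addrC addrA.
have r0 : 0 <= r by apply: le_trans ar.
have := dot_contract (col_mx p (- e)) symmx_uzawa_block r0 leF Fle.
rewrite FE !dot_col_mx dotNl dotNr opprK ppE => main.
rewrite E1E split_dot sqr_sqrtr // {1 2}wE split_dot.
(* The component [w2], which [J] kills, is only damped, and [a^2 <= r^2] suffices; for [a = 0] both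
   sides are 0. *)
have : a * dot w2 w2 <= r ^+ 2 * (a^-1 * dot w2 w2).
  have [->|an0] := eqVneq a 0; first by rewrite invr0 !mul0r mulr0.
  rewrite mulrA ler_wpM2r ?dotvv_ge0 // ler_pdivlMr ?lt0r ?an0 //.
  by rewrite -expr2 ler_sqr ?nnegrE.
move: (dot w2 w2) (dot w1 w1) (dot z1 z1) (dot E2 E2) (dot e e) main => d2 d1 dz dE de.
clear => h1 h2; lra.
Qed.
End UzawaBlock.

(** * Positivity of [delta] *)

Section Delta.
Context {K : rcfType}.

(** A zero [z] of a semidefinite form satisfies [D z = 0], hence [z = 0]. *)
Lemma sympsd_unitmx_sympd p (D : 'M[K]_p) : sympsd D -> D \in unitmx -> sympd D.
Proof.
move=> [DT Dpsd] Du; split=> // z z0; rewrite lt0r Dpsd andbT.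
apply: contraNneq z0 => Dz; rewrite -(mulKmx Du z).
suff -> : D *m z = 0 by rewrite mulmx0.
set v := D *m z in Dz *; apply/eqP; rewrite -dotvv_eq0; apply: contraT => vn0.
have M0 := Dpsd v; have M1 : 0 < dot (D *m v) v + 1 by rewrite ltr_wpDl.
(* [<D (z + s v), z + s v> = 2 s |v|^2 + s^2 <D v, v>] is negative for a small
   negative [s] unless [v = 0]. *)
pose s := - dot v v / (dot (D *m v) v + 1).
have := Dpsd (z + s *: v).
rewrite mulmxDr -scalemxAr !dotE (dot_symm v z) // -/v Dz.
set N := dot v v in vn0 s *; set M := dot (D *m v) v in M0 M1 s *.
have -> : 0 + s * N + (s * N + s * (s * M)) = - (N ^+ 2 * (M + 2)) / (M + 1) ^+ 2.
  by rewrite /s; field; rewrite gt_eqF.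
rewrite mulNr oppr_ge0 leNgt divr_gt0 ?exprn_gt0 // mulr_gt0 ?ltr_wpDl //.
by rewrite exprn_gt0 // lt0r vn0 dotvv_ge0.
Qed.

(** A finite [c] is nonnegative: an eigenvector yields [z] with [N z = c D z], and both forms are
    tested at [z]. *)
Lemma delta_gt0 p (D N : 'M[K]_p) (l : K) c : 0 < l -> sympsd D -> sympsd N ->
  is_c0 D N c -> 0 < delta l c.
Proof.
move=> l0 Dpsd [NT Npsd]; rewrite /is_c0; case: ifP => [Du|_ ->]; last by rewrite invr_gt0.
move=> [a [/eigenvalueP[v vE v0] _] ->] /=.
suff a0 : 0 <= a by rewrite divr_gt0 ?mulr_gt0 ?ltr_pwDl.
have [DT Dpos] := sympsd_unitmx_sympd Dpsd Du.
pose z := (v *m invmx D)^T.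
have z0 : z != 0.
  rewrite trmx_eq0; apply: contraNneq v0 => vD0.
  by rewrite -[v](mulmxKV Du) vD0 mul0mx.
have zN : N *m z = a *: (D *m z).
  rewrite -{1}NT -{1}DT -!trmx_mul -linearZ /= mulmxKV //; congr (_^T).
  by rewrite -mulmxA.
by have := Npsd z; rewrite zN dotZl pmulr_lge0 // Dpos.
Qed.
End Delta.

Lemma invmxM {K : rcfType} p (X Y : 'M[K]_p) : X \in unitmx -> Y \in unitmx ->
  invmx (X *m Y) = invmx Y *m invmx X.
Proof.
move=> Xu Yu; have XYu : X *m Y \in unitmx by rewrite unitmx_mul Xu.
by rewrite -[RHS](mulKmx XYu) -[X *m Y *m _]mulmxA mulKVmx // mulmxV // mulmx1.
Qed.

Unset Implicit Arguments.
Set Strict Implicit.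


Theorem theorem3p2 (K : rcfType) (n m : nat) (hm : (1 <= m)%N) (hmn : (m <= n)%N)
  (A : 'M[K]_n) (B : 'M[K]_(n, m)) (D S : 'M[K]_m)
  (hA : sympd A) (hD : sympsd D)
  (ES : S = B^T *m invmx A *m B + D) (hS : sympd S)
  (f : 'cV[K]_n) (g : 'cV[K]_m) (x : 'cV[K]_n) (y : 'cV[K]_m)
  (sol1 : A *m x + B *m y = f) (sol2 : B^T *m x - D *m y = g)
  (hatA : 'M[K]_n) (hatS H : 'M[K]_m)
  (hhatA : sympd hatA) (hhatS : sympd hatS)
  (EH : H = B^T *m invmx hatA *m B + D)
  (xi x1 fi ri f1 : 'cV[K]_n) (yi y1 gi si : 'cV[K]_m)
  (omegai tauhati taui thetai : K)
  (Efi : fi = f - (A *m xi + B *m yi))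
  (Eri : ri = invmx hatA *m fi)
  (Eomegai : omegai = dot fi ri / dot (A *m ri) ri)
  (Ex1 : x1 = xi + omegai *: ri)
  (Egi : gi = B^T *m x1 - D *m yi - g)
  (Esi : si = invmx hatS *m gi)
  (Etauhati : tauhati = dot gi si / dot (H *m si) si)
  (hthetai : 0 < thetai)
  (Etaui : taui = thetai * tauhati)
  (Ey1 : y1 = yi + taui *: si)
  (Ef1 : f1 = f - A *m x1 - B *m y1)
  (hfi : fi != 0) (hgi : gi != 0)
  (sqrtA : 'M[K]_n) (sqrtH sqrtS : 'M[K]_m)
  (hsqrtA : is_sqrtmx A sqrtA) (hsqrtH : is_sqrtmx H sqrtH)
  (hsqrtS : is_sqrtmx S sqrtS)
  (kappa1 kappa2 alpha beta lambda lambda0 delta1 delta2 alphai betai : K)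
  (c0 : \bar K)
  (hkappa1 : is_cond (invmx hatA *m A) kappa1)
  (hkappa2 : is_cond (invmx hatS *m H) kappa2)
  (Ealpha : alpha = (kappa1 - 1) / (kappa1 + 1))
  (Ebeta : beta = (kappa2 - 1) / (kappa2 + 1))
  (hlambda : 0 < lambda <= 1) (hlambda0 : 1 <= lambda0)
  (hlambdaA : loewner_le (lambda *: hatA) A)
  (hAlambda0 : loewner_le A (lambda0 *: hatA))
  (hc0 : is_c0 D (B^T *m invmx hatA *m B) c0)
  (Edelta1 : delta1 = delta lambda0 c0)
  (Edelta2 : delta2 = delta lambda c0)
  (Ealphai : alphai =
     enorm ((1%:M - omegai *: (sqrtA *m invmx hatA *m sqrtA))
              *m (invmx sqrtA *m fi))
     / enorm (invmx sqrtA *m fi))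
  (Ebetai : betai =
     enorm ((1%:M - tauhati *: (sqrtH *m invmx hatS *m sqrtH))
              *m (invmx sqrtH *m gi))
     / enorm (invmx sqrtH *m gi))
  (Gi Qi : 'M[K]_m) (hGi : sympd Gi)
  (hGigi : invmx Gi *m gi = tauhati *: (invmx hatS *m gi))
  (hGieig : forall a : K, eigenvalue (sqrtS *m invmx Gi *m sqrtS) a ->
     (1 - betai) * delta1 <= a <= (1 + betai) * delta2)
  (EQi : invmx Qi = thetai *: invmx Gi)
  (U Sigma0 R : 'M[K]_m) (V : 'M[K]_n)
  (hsvd : is_svd (B^T *m invmx sqrtA) U Sigma0 V)
  (hR : R \in unitmx) (hSR : S = R *m R^T)
  (E1i E1i1 : 'cV[K]_n) (E2i E2i1 : 'cV[K]_m)
  (EE1i : E1i = Num.sqrt alpha *: (V^T *m invmx sqrtA *m fi))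
  (EE2i : E2i = R^T *m (y - yi))
  (EE1i1 : E1i1 = Num.sqrt alpha *: (V^T *m invmx sqrtA *m f1))
  (EE2i1 : E2i1 = R^T *m (y - y1))
  (c1 : K)
  (hc1 : loewner_le (Sigma0^T *m U^T *m invmx Qi *m U *m Sigma0)
                    (c1 *: (R^T *m invmx Qi *m R)))
  (Fi : 'M[K]_(m + m))
  (EFi : Fi = block_mx
     (alpha *: (1%:M + Sigma0^T *m U^T *m invmx Qi *m U *m Sigma0))
     (Num.sqrt alpha *: (Sigma0^T *m U^T *m invmx Qi *m R))
     (Num.sqrt alpha *: (R^T *m invmx Qi *m U *m Sigma0))
     (- (1%:M - R^T *m invmx Qi *m R)))
  (mu mutilde : K)
  (hmu : alpha < mu < 1)
  (hthetamu : thetai <= 1 / (delta2 * (1 + beta)) * gamma mu alpha c1)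
  (hmutilde : beta <= mutilde < 1)
  (hmutildetheta :
     1 - mutilde <=
       delta1 * (1 - beta)
         / (1 + c1 * (alpha / (alpha + beta)) * gamma mu alpha c1) * thetai) :
  [/\ loewner_le (- mutilde *: 1%:M) Fi,
      loewner_le Fi (mu *: 1%:M) &
      enorm E1i1 ^+ 2 + enorm E2i1 ^+ 2 <=
        Num.max mu mutilde ^+ 2
          * (alphai ^+ 2 / alpha ^+ 2 * enorm E1i ^+ 2 + enorm E2i ^+ 2)].
Proof.

(* Constants of the iteration and the bounds on [Fi] *)
have [sApd sAA] := hsqrtA; have [sHpd sHH] := hsqrtH; have [sSpd sSS] := hsqrtS.
have sAu := sympd_unitmx sApd; have sSu := sympd_unitmx sSpd.
have [sAT _] := sApd; have isAT := symmx_inv sAT.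
have iA : invmx A = invmx sqrtA *m invmx sqrtA by rewrite -sAA invmxM.
have [k1 /andP[al0 alle]] : 1 <= kappa1 /\ 0 <= alphai <= alpha.
  by rewrite Ealphai Ealpha; apply: (descent_ratio hsqrtA hhatA hkappa1); rewrite -Eri.
have [k2 /andP[be0 bele]] : 1 <= kappa2 /\ 0 <= betai <= beta.
  by rewrite Ebetai Ebeta; apply: (descent_ratio hsqrtH hhatS hkappa2); rewrite -Esi.
have a0 : 0 <= alpha := le_trans al0 alle.
have b0 : 0 <= beta := le_trans be0 bele.
have [/andP[amu mu1] /andP[bmt mt1]] := (hmu, hmutilde).
have [/andP[lam0 _] lam00] := (hlambda, lt_le_trans ltr01 hlambda0).
have Npsd : sympsd (B^T *m invmx hatA *m B).
  have iApd := sympd_inv hhatA; split.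
    by rewrite /symmx !trmx_mul trmxK (proj1 iApd) mulmxA.
  by move=> phi; rewrite -!mulmxA dot_mull trmxK sympd_ge0.
have d10 : 0 < delta1 by rewrite Edelta1 (delta_gt0 lam00 hD Npsd).
have d20 : 0 < delta2 by rewrite Edelta2 (delta_gt0 lam0 hD Npsd).
have iGpd := sympd_inv hGi.
have Tpd : sympd (invmx Qi).
  split; first by rewrite EQi /symmx linearZ /= (proj1 iGpd).
  by move=> phi phi0; rewrite EQi -scalemxAl dotZl mulr_gt0 // (proj2 iGpd).
set T := invmx Qi in EQi hc1 EFi Tpd *.
have [X XE] : exists X, X = U *m Sigma0 by eexists.
have [UO VO [_ _] BE] := hsvd.
have TXX : Sigma0^T *m U^T *m T *m U *m Sigma0 = X^T *m T *m X.
  by rewrite XE trmx_mul !mulmxA.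
have {}EFi : Fi = uzawa_block alpha T X R.
  by rewrite EFi TXX /uzawa_block XE trmx_mul !mulmxA.
rewrite TXX in hc1.
(* As [S = R R^T], the matrix [S^{-1/2} R] is orthogonal, so the eigenvalue interval assumed for
   [S^{1/2} G_i^{-1} S^{1/2}] also bounds [R^T G_i^{-1} R]; then [betai] is enlarged to [beta]. *)
have Rbnd q : thetai * (delta1 * (1 - beta)) * dot q q <= dot (T *m (R *m q)) (R *m q)
              <= thetai * (delta2 * (1 + beta)) * dot q q.
  pose z := invmx sqrtS *m (R *m q).
  have zz : dot z z = dot q q.
    rewrite /z dot_mull (symmx_inv (proj1 sSpd)) [invmx sqrtS *m (_ *m _)]mulmxA -invmxM // sSS.
    rewrite hSR invmxM ?unitmx_tr // -mulmxA mulKmx // dot_mull.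
    by rewrite mulKVmx ?unitmx_tr.
  have Tz : dot (T *m (R *m q)) (R *m q) = thetai * dot (sqrtS *m invmx Gi *m sqrtS *m z) z.
    rewrite EQi -scalemxAl dotZl; congr (_ * _).
    rewrite /z -[sqrtS *m _ *m _ *m _]mulmxA mulKVmx // -mulmxA (dot_symm _ _ (proj1 sSpd)).
    by rewrite mulKVmx.
  have WT : symmx (sqrtS *m invmx Gi *m sqrtS).
    by rewrite /symmx !trmx_mul (proj1 sSpd) (proj1 iGpd) mulmxA.
  have := rayleigh_bounds z WT hGieig; rewrite Tz zz => /andP[lo hi].
  have q0 := dotvv_ge0 q.
  rewrite -!mulrA !ler_pM2l //; apply/andP; split.
    apply: le_trans lo; rewrite mulrA ler_wpM2r // mulrC ler_wpM2r ?(ltW d10) //.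
    by rewrite lerD2l lerN2.
  apply: (le_trans hi); rewrite [X in _ <= X]mulrA ler_wpM2r // mulrC ler_wpM2l ?(ltW d20) //.
  by rewrite lerD2l.
have xbnd p : dot (T *m (X *m p)) (X *m p) <= c1 * dot (T *m (R *m p)) (R *m p).
  have := hc1 p; rewrite -scalemxAl dotZl -!mulmxA ![dot (_^T *m _) _]dot_mull.
  by rewrite !trmxK.
(* Both forms are compared at one nonzero vector, which exists because [m >= 1]. *)
have c10 : 0 <= c1.
  have v0 : const_mx 1 != 0 :> 'cV[K]_m.
    apply/eqP => /matrixP/(_ (Ordinal hm) 0); rewrite !mxE => /eqP.
    by rewrite oner_eq0.
  have Rv0 : R *m const_mx 1 != 0 :> 'cV[K]_m.
    by apply: contraNneq v0 => Rv0; rewrite -(mulKmx hR (const_mx 1)) Rv0 mulmx0.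
  have := le_trans (sympd_ge0 _ Tpd) (xbnd (const_mx 1)).
  by rewrite pmulr_lge0 // (proj2 Tpd).
set gam := gamma mu alpha c1 in hthetamu hmutildetheta *.
have db0 : 0 < delta2 * (1 + beta) by rewrite mulr_gt0 // ltr_pwDl.
pose t := thetai * (delta2 * (1 + beta)).
have t0 : 0 < t by rewrite mulr_gt0.
have tgam : t <= gam by rewrite /t -ler_pdivlMr // mulrC -[X in X * _]mul1r.
have gam0 : 0 < gam := lt_le_trans t0 tgam.
(* The upper estimate takes [d = t], the lower one [d = gam], matching the denominator in the
   condition on [mutilde]. *)
have XbndC d : t <= d -> forall p, dot (T *m (X *m p)) (X *m p) <= c1 * d * dot p p.
  move=> td p; apply: (le_trans (xbnd p)); rewrite -mulrA ler_wpM2l //.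
  have /andP[_ h] := Rbnd p; apply: (le_trans h); rewrite ler_wpM2r ?dotvv_ge0 //.
have Fle : loewner_le Fi (mu *: 1%:M).
  rewrite EFi; apply: (uzawa_block_le a0 Tpd amu c10 (ltW t0) tgam); first exact: XbndC.
  by move=> q; have /andP[] := Rbnd q.
have leF : loewner_le (- mutilde *: 1%:M) Fi.
  rewrite EFi; apply: (@uzawa_block_ge _ _ _ _ _ _ a0 Tpd c1 gam
    (thetai * (delta1 * (1 - beta))) beta) => //; first exact: ltW.
  - by rewrite b0.
  - by rewrite -mulrA mulrC.
  - exact: XbndC.
  - by move=> q; have /andP[] := Rbnd q.
split=> //.

(* The error recursion in singular coordinates *)
pose J : 'M[K]_(m, n) := pid_mx m.
have JJ : J *m J^T = 1%:M.
  by rewrite /J tr_pid_mx mul_pid_mx minnn (minn_idPr hmn) pid_mx_1.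
pose w := (1%:M - omegai *: (sqrtA *m invmx hatA *m sqrtA)) *m (invmx sqrtA *m fi).
have ww : dot w w = alphai ^+ 2 * dot (invmx sqrtA *m fi) (invmx sqrtA *m fi).
  rewrite -!enorm_sqr -exprMn Ealphai -/w divfK // -sqrf_eq0 enorm_sqr dotvv_eq0.
  by apply: contraNneq hfi => h; rewrite -(mulKVmx sAu fi) h mulmx0.
have w1E : w = invmx sqrtA *m (fi - omegai *: (A *m ri)).
  rewrite /w mulmxBl mul1mx mulmxBr -scalemxAl -scalemxAr Eri -sAA.
  by rewrite -!mulmxA mulKmx // mulKVmx.
(* Up to [A^{-1/2}], [w] is the first residual at [(x1, yi)]. *)
have w2E : w = invmx sqrtA *m (A *m (x - x1) + B *m (y - yi)).
  rewrite w1E; congr (_ *m _); rewrite Efi -sol1 Ex1 !mulmxBr mulmxDr -scalemxAr.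
  move: (A *m x) (A *m xi) (A *m ri) (B *m y) (B *m yi) => *.
  by apply/matrixP => i j; rewrite !mxE; ring.
have BwE : B^T *m (invmx sqrtA *m w) = B^T *m (x - x1) + B^T *m invmx A *m B *m (y - yi).
  rewrite w2E [invmx sqrtA *m _]mulmxA -iA mulmxDr mulKmx ?sympd_unitmx //.
  by rewrite mulmxDr !mulmxA.
(* [R E2i] is [S (y - yi)]; subtracting [B^T A^{-1/2} w] cancels [B^T A^{-1} B (y - yi)] and leaves
   [D (y - yi) - B^T (x - x1)]. *)
have giE : gi = R *m E2i - X *m (J *m (V^T *m w)).
  have -> : X *m (J *m (V^T *m w)) = B^T *m (invmx sqrtA *m w).
    by rewrite [B^T *m _]mulmxA BE /pad0 -/J XE !mulmxA.
  rewrite BwE EE2i mulmxA -hSR ES Egi -sol2 mulmxDl !mulmxBr.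
  move: (B^T *m x) (B^T *m x1) (D *m y) (D *m yi) (_ *m y) (_ *m yi).
  by move=> *; apply/matrixP => i j; rewrite !mxE; ring.
have f1E : V^T *m (invmx sqrtA *m f1) = V^T *m w - J^T *m (X^T *m (T *m gi)).
  have iAB : invmx sqrtA *m B = V *m (J^T *m X^T).
    rewrite -[LHS]trmxK trmx_mul isAT BE /pad0 -/J [U *m (_ *m _)]mulmxA -XE.
    by rewrite !trmx_mul trmxK.
  (* The defining property of [Gi] makes the nonlinear step the action of a fixed matrix on [gi]. *)
  have tauE : taui *: si = T *m gi.
    by rewrite Etaui Esi -scalerA -hGigi EQi scalemxAl.
  have -> : f1 = (fi - omegai *: (A *m ri)) - B *m (T *m gi).
    rewrite -tauE Ef1 Efi Ex1 Ey1 !mulmxDr -!scalemxAr.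
    move: (A *m xi) (A *m ri) (B *m yi) (B *m si) => *.
    by apply/matrixP => i j; rewrite !mxE; ring.
  rewrite mulmxBr -w1E mulmxBr; congr (_ - _).
  by rewrite [_ *m (B *m _)]mulmxA iAB !mulmxA VO mul1mx.
have VVw : dot (V^T *m w) (V^T *m w) = dot w w.
  by rewrite dot_isometry // trmxK; apply: mulmx1C.
rewrite EFi in leF Fle.
rewrite !enorm_sqr.
(* By definition of [alphai], [|w| = alphai |A^{-1/2} f_i|]. At [alpha = 0] both sides are 0 by the
   convention for the inverse of 0. *)
have RHS : alphai ^+ 2 / alpha ^+ 2 * dot E1i E1i = alpha^-1 * dot (V^T *m w) (V^T *m w).
  rewrite VVw ww EE1i dotZl dotZr -mulmxA.
  rewrite (dot_isometry (M := V^T)) ?trmxK; last exact: mulmx1C.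
  rewrite [in X in _ * X]mulrA -expr2 sqr_sqrtr //.
  have [->|an0] := eqVneq alpha 0; first by rewrite invr0 !(mul0r, mulr0).
  by field.
rewrite RHS.
apply: (@uzawa_error_le _ _ alpha T X R a0 Tpd n J _ _ _ gi _ (Num.max mu mutilde) JJ).
- move=> al; have al_i : alphai = 0 by apply/eqP; rewrite eq_le al0 andbT -al.
  by apply/eqP; rewrite -dotvv_eq0 VVw ww al_i expr0n mul0r.
- by rewrite le_max ltW.
- move=> phi; apply: le_trans (leF phi); rewrite -!scalemxAl !dotZl.
  by rewrite ler_wpM2r ?lerN2 ?le_max ?lexx ?orbT // mul1mx dotvv_ge0.
- move=> phi; apply: (le_trans (Fle phi)); rewrite -!scalemxAl !dotZl.
  by rewrite ler_wpM2r ?le_max ?lexx // mul1mx dotvv_ge0.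
- by [].
- by rewrite EE1i1 -mulmxA f1E.
- rewrite EE2i1 EE2i Ey1 Etaui Esi -scalerA -hGigi [thetai *: _]scalemxAl -EQi.
  by rewrite -mulmxBr opprD addrA.
Qed.
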